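(* Let $R$ be a ring with the property that each countably generated left $R$-module is countably presented. Then each left $R$-module $M$ is the directed union of those countably generated submodules of $M$ which have projective dimension bounded above by the projective dimension of $M$.
   Context: A left $R$-module $X$ is countably presented if there is an exact sequence $R^{(K)}\to R^{(L)}\to X\to 0$ with index sets satisfying $|K|,|L|\le\aleph_0$, where $R^{(K)}$ denotes the direct sum of $K$ copies of $R$. The assertion that $M$ is the directed union of a family of submodules means that the family is directed under inclusion and its union is $M$. *)

(* Defs.v *)
From HB Require Import structures.
From mathcomp Require Import all_boot all_order all_algebra.
From mathcomp Require Import all_classical all_reals.

Set Implicit Arguments.
Unset Strict Implicit.
Unset Printing Implicit Defensive.

Import Order.TTheory GRing.Theory Num.Theory.

Local Open Scope classical_set_scope.
Local Open Scope ring_scope.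

(* [pzRingType] is an arbitrary associative unital ring, not necessarily
   commutative and possibly zero; [lmodType R] is the type of left
   R-modules.  The library's [submodClosed M] bundles a (boolean, hence
   classically arbitrary) subset of M with its closure under the module
   operations, i.e. it is the type of submodules of M. *)

Section SubmoduleAsModule.
Variables (R : pzRingType) (M : lmodType R) (N : submodClosed M).

Record submod_type := SubmodType {
  submod_val : M;
  submod_valP : submod_val \in N }.

HB.instance Definition _ := [isSub for submod_val].
HB.instance Definition _ := [Choice of submod_type by <:].
HB.instance Definition _ := [SubChoice_isSubLmodule of submod_type by <:].
End SubmoduleAsModule.

Section DirectSum.
Variables (R : pzRingType) (K : Type).

Definition finsupp_fun : {pred K -> R^o} :=
  fun f => `[< finite_set [set k | f k != 0] >].

Lemma finsupp_fun_submod_closed : submod_closed finsupp_fun.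
Proof.
split.
  apply/asboolP; rewrite (_ : [set k | _] = set0) //.
  by apply/seteqP; split => k //=; rewrite eqxx.
move=> a f g /asboolP ff /asboolP fg; apply/asboolP.
have : finite_set ([set k | f k != 0] `|` [set k | g k != 0]).
  by rewrite finite_setU.
apply: sub_finite_set => k /= afg; apply/orP; move: afg; apply: contraNT.
rewrite negb_or !negbK => /andP[/eqP fk0 /eqP gk0].
have -> : (a *: f + g) k = a *: f k + g k by [].
by rewrite fk0 gk0 scaler0 addr0.
Qed.

HB.instance Definition _ :=
  GRing.isSubmodClosed.Build R (K -> R^o) finsupp_fun
    finsupp_fun_submod_closed.

(* R^(K) *)
Definition dsum : lmodType R := @submod_type R (K -> R^o) finsupp_fun.
End DirectSum.

Section Modules.
Variable R : pzRingType.
Implicit Types (X M P : lmodType R).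

Definition exact_at (A B C : lmodType R)
    (f : {linear A -> B}) (g : {linear B -> C}) : Prop :=
  range f = [set b | g b = 0].

Definition countably_generated X : Prop :=
  exists2 A : set X, countable A &
    forall N : submodClosed X, (forall x, A x -> x \in N) ->
      forall x, x \in N.

Definition countably_presented X : Prop :=
  exists K L : Type, [/\ countable [set: K], countable [set: L] &
    exists (f : {linear dsum R K -> dsum R L}) (g : {linear dsum R L -> X}),
      exact_at f g /\ range g = [set: X]].

Definition projective P : Prop :=
  forall (A B : lmodType R) (g : {linear A -> B}) (f : {linear P -> B}),
    range g = [set: B] ->
    exists h : {linear P -> A}, forall x, g (h x) = f x.

(* M has a projective resolution
     ... -> P 2 -> P 1 -> P 0 -> M -> 0   with P i = 0 for all i > n. *)
Definition has_proj_resolution M (n : nat) : Prop :=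
  exists (P : nat -> lmodType R) (d : forall i, {linear P i.+1 -> P i})
         (e : {linear P 0%N -> M}),
    [/\ forall i, projective (P i),
        range e = [set: M],
        exact_at (d 0%N) e,
        forall i, exact_at (d i.+1) (d i)
      & forall i, (n < i)%N -> forall x : P i, x = 0].

(* Values are extended integers, so that infinite projective dimension is
   +oo; the zero module gets projective dimension 0. *)
Definition proj_dim M : \bar int :=
  match pselect (exists n, `[< has_proj_resolution M n >]) with
  | left ex => (Posz (ex_minn ex))%:E
  | right _ => +oo%E
  end.

Definition is_directed_union M (F : set (submodClosed M)) : Prop :=
  [/\ F !=set0,
      forall N1 N2, F N1 -> F N2 ->
        exists N3, [/\ F N3, {subset N1 <= N3} & {subset N2 <= N3}]
    & \bigcup_(N in F) [set x | x \in N] = [set: M]].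

End Modules.

(* Main.v *)
Require Import Defs.
From HB Require Import structures.
From mathcomp Require Import all_boot all_order all_algebra.
From mathcomp Require Import all_classical all_reals.

(* Let P be a projective resolution of M and choose, for each i, a section s_i
   of the canonical surjection R^(P_i) -> P_i. Starting from a countable subset
   of M, a countable closing-off argument yields countable S_i in P_i such that
   the supports of s_i x, for x in S_i, lie in S_i; d maps S_(i+1) into S_i; and
   every cycle in <S_i> is a boundary from <S_(i+1)>. The last point is possible
   because the kernel of d on <S_i> is countably generated: its image in
   P_(i-1) is countably generated, hence countably presented. Closure under
   supports makes <S_i> projective, so the <S_i> resolve the submodule of M
   generated by the image of S_0, with no more nonzero terms than P has. *)

Set Implicit Arguments.
Unset Strict Implicit.
Unset Printing Implicit Defensive.

Local Open Scope classical_set_scope.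
Local Open Scope ring_scope.

Import Order.TTheory GRing.Theory Num.Theory.

(** * Countable sets and linear maps *)

Lemma countable_image (T U : Type) (f : T -> U) (A : set T) :
  countable A -> countable (f @` A).
Proof. by apply: sub_countable; exact: card_image_le. Qed.

Lemma countableU (T : Type) (A B : set T) :
  countable A -> countable B -> countable (A `|` B).
Proof.
by move=> cA cB; rewrite -bigcup2E; apply: bigcup_countable => // -[|[|i]].
Qed.

Definition to_linear (R : pzRingType) (A B : lmodType R) (f : A -> B)
    (fl : linear f) : {linear A -> B} :=
  HB.pack f (GRing.isLinear.Build R A B *:%R f fl).

(** * Submodules spanned by a set *)

Section Span.
Context {R : pzRingType} {M : lmodType R}.

(** An intersection of submodules rather than a set of finite combinations, to match the quantifier
    in [countably_generated]. *)
Definition lspan (A : set M) : {pred M} := fun x =>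
  `[< forall N : submodClosed M, (forall y, A y -> y \in N) -> x \in N >].

Lemma lspan_submod_closed A : submod_closed (lspan A).
Proof.
split; first by apply/asboolP => N _; exact: rpred0.
move=> a x y /asboolP xA /asboolP yA; apply/asboolP => N AN.
by rewrite rpredD ?rpredZ ?xA ?yA.
Qed.

HB.instance Definition _ A :=
  GRing.isSubmodClosed.Build R M (lspan A) (lspan_submod_closed A).

Lemma sub_lspan (A : set M) x : A x -> x \in lspan A.
Proof. by move=> Ax; apply/asboolP => N; exact. Qed.

(** The elements satisfying [Q] form a submodule containing [A]. *)
Lemma lspan_ind (A : set M) (Q : M -> Prop) : Q 0 ->
  (forall a x y, Q x -> Q y -> Q (a *: x + y)) ->
  (forall x, A x -> Q x) -> forall x, x \in lspan A -> Q x.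
Proof.
move=> Q0 Ql QA x /asboolP xA.
pose q : {pred M} := fun x => `[< Q x >].
have qP : submod_closed q.
  split; first exact/asboolP.
  by move=> a y z /asboolP Qy /asboolP Qz; apply/asboolP/Ql.
pose qm := GRing.isSubmodClosed.Build R M q qP.
pose N : submodClosed M := HB.pack q qm.
have /asboolP// : x \in N.
by apply: xA => y /QA Qy; exact/asboolP.
Qed.

Lemma lspan_sub (A : set M) (N : submodClosed M) :
  (forall x, A x -> x \in N) -> {subset lspan A <= N}.
Proof. by move=> AN x /asboolP; exact. Qed.

Lemma lspan_mono (A B : set M) : A `<=` B -> {subset lspan A <= lspan B}.
Proof. by move=> AB; apply: lspan_sub => x /AB; exact: sub_lspan. Qed.

Lemma lspan_bigcup (S : nat -> set M) :
  {homo S : m n / (m <= n)%N >-> m `<=` n} ->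
  forall x, x \in lspan (\bigcup_k S k) -> exists k, x \in lspan (S k).
Proof.
move=> Smono; apply: lspan_ind.
- by exists 0%N; exact: rpred0.
(* Two witnesses move to a common stage because [S] is increasing. *)
- move=> a x y [k xk] [l yl]; exists (maxn k l); apply: rpredD.
  + by apply/rpredZ/(lspan_mono (Smono _ _ (leq_maxl k l)))/xk.
  + exact/(lspan_mono (Smono _ _ (leq_maxr k l)))/yl.
- by move=> x [k _ Skx]; exists k; exact: sub_lspan.
Qed.

End Span.

Lemma lspan_image (R : pzRingType) (A B : lmodType R) (f : {linear A -> B})
  (S : set A) x : x \in lspan (f @` S) -> exists2 a, a \in lspan S & f a = x.
Proof.
move: x; apply: lspan_ind.
- by exists 0; [exact: rpred0 | exact: linear0].
- move=> c x y [u uS <-] [v vS <-]; exists (c *: u + v); last exact: linearP.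
  by rewrite rpredD ?rpredZ.
- by move=> _ [a Sa <-]; exists a => //; exact: sub_lspan.
Qed.

Lemma linear_lspan (R : pzRingType) (A B : lmodType R) (f : {linear A -> B})
  (S : set A) (N : submodClosed B) : (forall x, S x -> f x \in N) ->
  forall x, x \in lspan S -> f x \in N.
Proof.
move=> SN; apply: lspan_ind => //; first by rewrite linear0 rpred0.
by move=> c x y fx fy; rewrite linearP rpredD ?rpredZ.
Qed.

(** * Submodules regarded as modules *)

Section Submodules.
Context {R : pzRingType}.
Implicit Types A B M : lmodType R.

Lemma submod_val_inj M (N : submodClosed M) :
  injective (@submod_val R M N).
Proof. exact: val_inj. Qed.

Lemma submod_valD M (N : submodClosed M) c (x y : submod_type N) :
  submod_val (c *: x + y) = c *: submod_val x + submod_val y.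
Proof. by []. Qed.

(** Total on [M], with value 0 outside [N], so that it can be composed without membership proofs. *)
Definition submod_of M (N : submodClosed M) (x : M) : submod_type N :=
  insubd 0 x.

Lemma submod_ofK M (N : submodClosed M) x :
  x \in N -> submod_val (submod_of N x) = x.
Proof. by move=> xN; rewrite /submod_of val_insubd xN. Qed.

Lemma submod_valK M (N : submodClosed M) (x : submod_type N) :
  submod_of N (submod_val x) = x.
Proof. by apply: submod_val_inj; rewrite submod_ofK //; exact: submod_valP. Qed.

Lemma restrict_linear A B (N : submodClosed A) (N' : submodClosed B)
  (f : {linear A -> B}) : (forall x, x \in N -> f x \in N') ->
  exists g : {linear submod_type N -> submod_type N'},
    forall x, submod_val (g x) = f (submod_val x).
Proof.
move=> fN.
pose g (x : submod_type N) : submod_type N' := SubmodType (fN _ (submod_valP x)).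
have gl : linear g.
  by move=> a x y; apply: submod_val_inj; exact: linearP.
by by exists (to_linear gl).
Qed.

Lemma countably_generated_lspan M (S : set M) :
  countable S -> countably_generated (submod_type (lspan S)).
Proof.
move=> cS; exists (submod_of (lspan S) @` S).
  exact: countable_image.
move=> N SN x.
suff H y : y \in lspan S -> submod_of (lspan S) y \in N.
  by rewrite -(submod_valK x); apply/H/submod_valP.
(* Membership is carried through the induction because [submod_of] respects linear combinations only
   inside the span. *)
move=> yS; suff [] : y \in lspan S /\ submod_of (lspan S) y \in N by [].
move: y yS; apply: lspan_ind.
- split; first exact: rpred0.
  rewrite (_ : submod_of _ _ = 0) ?rpred0//.
  by apply: submod_val_inj; rewrite submod_ofK ?rpred0.
- move=> c x1 y [xS xN] [yS yN]; split; first by rewrite rpredD ?rpredZ.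
  rewrite (_ : submod_of _ _ = c *: submod_of _ x1 + submod_of _ y)
    ?rpredD ?rpredZ//.
  by apply: submod_val_inj; rewrite submod_valD !submod_ofK// rpredD ?rpredZ.
- by move=> y Sy; split; [exact: sub_lspan | apply: SN; exists y].
Qed.

Lemma countably_generated_submod M (N : submodClosed M) :
  countably_generated (submod_type N) ->
  exists2 S : set M, countable S & {subset N <= lspan S}.
Proof.
move=> [A cA AN]; exists (@submod_val R M N @` A); first exact: countable_image.
move=> x xN; have : SubmodType xN \in lspan A
  by apply: AN => y; exact: sub_lspan.
rewrite -{2}[x]/(submod_val (SubmodType xN)).
apply: (linear_lspan (f := (\val : {linear submod_type N -> M}))) => y Ay.
by apply: sub_lspan; exists y.
Qed.

End Submodules.

(** * Linear combinations with coefficients in the free module on [K] *)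

Section LinearCombinations.
Context {R : pzRingType} {K : choiceType}.
Implicit Types (M : lmodType R) (f : dsum R K).

(** The map given by the universal property of the free module: it sends the basis vector at [k] to
    [a k]. *)
Definition lincomb M (a : K -> M) f : M :=
  \sum_(k \in [set k | submod_val f k != 0]) (submod_val f k : R) *: a k.

Lemma finite_supp f : finite_set [set k | submod_val f k != 0].
Proof. by have /asboolP := submod_valP f. Qed.

(** Lets combinations with different supports be summed over one index set, as additivity
    requires. *)
Lemma lincombE M (a : K -> M) f (D : set K) :
  (forall k, submod_val f k != 0 -> D k) ->
  lincomb a f = \sum_(k \in D) (submod_val f k : R) *: a k.
Proof.
move=> fD; apply: fsbig_widen => // k [_ /= /negP/negPn/eqP ->].
exact: scale0r.
Qed.

Lemma lincomb_is_linear M (a : K -> M) : linear (lincomb a).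
Proof.
move=> c f g.
pose D := [set k | submod_val f k != 0] `|` [set k | submod_val g k != 0].
have fD : finite_set D by rewrite finite_setU; split; exact: finite_supp.
rewrite (@lincombE _ _ f D) ?(@lincombE _ _ g D)
  ?(@lincombE _ _ (c *: f + g) D).
- rewrite !fsbig_finite// scaler_sumr -big_split /=; apply: eq_bigr => k _.
  by rewrite scalerA -scalerDl.
- move=> k; apply: contraNP => /not_orP
    [/= /negP/negPn/eqP f0 /negP/negPn/eqP g0].
  rewrite -[eqbLHS]/(c *: submod_val f k + submod_val g k).
  by rewrite f0 g0 scaler0 addr0.
- by move=> k; right.
- by move=> k; left.
Qed.

HB.instance Definition _ M (a : K -> M) :=
  GRing.isLinear.Build R (dsum R K) M *:%R (lincomb a) (lincomb_is_linear a).

Lemma eq_lincomb M (a b : K -> M) f :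
  (forall k, submod_val f k != 0 -> a k = b k) -> lincomb a f = lincomb b f.
Proof. by move=> ab; apply: eq_fsbigr => k; rewrite inE => /ab ->. Qed.

Lemma lincomb_mem M (N : submodClosed M) (a : K -> M) f :
  (forall k, submod_val f k != 0 -> a k \in N) -> lincomb a f \in N.
Proof.
move=> aN; rewrite /lincomb fsbig_finite; last exact: finite_supp.
rewrite big_seq; apply: rpred_sum => k.
rewrite in_fset_set; last exact: finite_supp.
by rewrite inE => /aN; exact: rpredZ.
Qed.

Lemma linear_lincomb (A B : lmodType R) (L : {linear A -> B}) (a : K -> A) f :
  L (lincomb a f) = lincomb (L \o a) f.
Proof.
rewrite /lincomb !fsbig_finite; try exact: finite_supp.
by rewrite linear_sum; apply: eq_bigr => k _; rewrite linearZ.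
Qed.

Lemma delta_finsupp (k : K) :
  (fun j => (j == k)%:R : R^o) \in finsupp_fun (R := R) (K := K).
Proof.
apply/asboolP; apply: (sub_finite_set _ (finite_set1 k)) => j /=.
by case: (j =P k) => //; rewrite eqxx.
Qed.

Definition delta (k : K) : dsum R K := SubmodType (delta_finsupp k).

Lemma lincomb_delta M (a : K -> M) k : lincomb a (delta k) = a k.
Proof.
rewrite (@lincombE _ _ _ [set k]); last first.
  by move=> j /=; case: (j =P k) => //; rewrite eqxx.
by rewrite fsbig_set1 /= eqxx scale1r.
Qed.

Lemma lincomb_deltas f : lincomb delta f = f.
Proof.
apply: submod_val_inj; apply/funext => j.
(* Coordinates are compared: evaluation at [j] is linear, so it passes inside the combination. *)
pose ev (g : dsum R K) : R^o := submod_val g j.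
have evl : linear ev by [].
pose evL : {linear dsum R K -> R^o} := to_linear evl.
rewrite -[LHS]/(evL (lincomb delta f)) linear_lincomb.
(* Adjoining [j] to the support covers the case where the coefficient at [j] is 0. *)
rewrite (@lincombE _ _ _ ([set k | submod_val f k != 0] `|` [set j]));
  last by left.
rewrite -(@fsbig_widen _ _ _ _ [set j]).
- by rewrite fsbig_set1 /= /ev /= eqxx; exact: mulr1.
- by move=> k; right.
- move=> k [_ /= kj]; rewrite /ev /=; case: eqP => [jk|_]; last exact: mulr0.
  by case: kj.
Qed.

Lemma linear_dsumE M (L : {linear dsum R K -> M}) f :
  L f = lincomb (L \o delta) f.
Proof. by rewrite -{1}[f]lincomb_deltas linear_lincomb. Qed.

End LinearCombinations.

(** * Kernels on countably generated submodules *)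

(** The image of the span of [S] is countably generated, hence countably presented. Its generators
    lift along [f]; the kernel then comes from the lifted relations and from the differences between
    elements of [S] and their rewritings in the lifted generators. *)
Lemma kernel_countably_generated (R : pzRingType)
  (hR : forall X : lmodType R, countably_generated X -> countably_presented X)
  (A B : lmodType R) (f : {linear A -> B}) (S : set A) : countable S ->
  exists2 T : set A, countable T /\ (forall x, T x -> f x = 0) &
    forall z, z \in lspan S -> f z = 0 -> z \in lspan T.
Proof.
move=> cS.
have [K [L [cK cL [phi [g [ex_phi_g g_surj]]]]]] :=
  hR _ (countably_generated_lspan (countable_image f cS)).
(* The index types are bare types; [Pchoice] supplies the choice structure that [lincomb] needs. *)
move: phi g ex_phi_g g_surj cK cL; elim/Pchoice: K => K; elim/Pchoice: L => L.
move=> phi g ex_phi_g g_surj cK cL.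
have /choice[a aP] : forall l, exists b,
    b \in lspan S /\ f b = submod_val (g (delta l)).
  move=> l; have [b bS bE] := lspan_image (submod_valP (g (delta l))).
  by exists b.
pose u : {linear dsum R L -> A} := lincomb a.
have fu t : f (u t) = submod_val (g t).
  rewrite -[u t]/(lincomb a t) linear_lincomb.
  rewrite -[RHS]/((\val \o g) t) [RHS]linear_dsumE.
  by apply: eq_lincomb => l _; rewrite /= (aP l).2.
have /choice[t tP] : forall s, exists t, S s -> f (u t) = f s.
  move=> s; have [Ss|nSs] := pselect (S s); last by exists 0.
  have fsS : f s \in lspan (f @` S) by apply: sub_lspan; exists s.
  have : [set: submod_type (lspan (f @` S))] (SubmodType fsS) by [].
  by rewrite -g_surj => -[t _ gt]; exists t; rewrite fu gt.
pose T := (fun s => s - u (t s)) @` S `|` range (fun k => u (phi (delta k))).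
have gphi w : g (phi w) = 0.
  by have : range phi (phi w) by []; rewrite ex_phi_g.
have T0 x : T x -> f x = 0.
  move=> [[s Ss <-]|[k _ <-]]; first by rewrite linearB /= tP// subrr.
  by rewrite fu gphi.
exists T; first split=> //.
- by rewrite /T; apply: countableU; exact: countable_image.
- move=> z zS fz0.
  (* Modulo the span of [T], every element of the span of [S] equals some [u v], since this holds
     for each [s] in [S]. *)
  have [v zv] : exists v, z - u v \in lspan T.
    move: z zS {fz0}; apply: lspan_ind.
    + by exists 0; rewrite linear0 subr0 rpred0.
    + move=> c x y [v xv] [w yw]; exists (c *: v + w).
      by rewrite linearP opprD addrACA -scalerBr rpredD ?rpredZ.
    + by move=> s Ss; exists (t s); apply: sub_lspan; left; exists s.
  have fT : forall x, x \in lspan T -> f x = 0.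
    apply: lspan_ind => [|c x y fx fy|x Tx]; first exact: linear0.
    + by rewrite linearP fx fy scaler0 addr0.
    + exact: T0.
  (* Since [f] kills both [z] and [z - u v], it kills [u v], so [g v = 0] and [v] is a relation. *)
  have [w _ wv] : range phi v.
    rewrite ex_phi_g; apply: submod_val_inj; rewrite -fu.
    by have /eqP := fT _ zv; rewrite linearB /= fz0 sub0r oppr_eq0 => /eqP.
  rewrite -[z](subrK (u v)) rpredD//.
  rewrite -wv -[u (phi w)]/((u \o phi) w) linear_dsumE.
  by apply: lincomb_mem => k _; apply: sub_lspan; right; exists k.
Qed.

(** * Projectivity of spans closed under supports *)

Lemma projective_section (R : pzRingType) (P : lmodType R) : projective P ->
  exists s : {linear P -> dsum R P}, forall x, lincomb id (s x) = x.
Proof.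
(* The free module on the underlying set of [P] maps onto [P]; the section lifts the identity. *)
move=> projP; pose g : {linear dsum R P -> P} := lincomb id.
have [|s sP] := projP (dsum R P) P g idfun; last by exists s.
by apply/seteqP; split=> // x _; exists (delta x) => //; exact: lincomb_delta.
Qed.

(** The section sends the span of [S] to coefficients supported in [S], so a map is lifted by
    choosing preimages on [S] and extending by linear combinations. *)
Lemma projective_lspan (R : pzRingType) (P : lmodType R)
  (s : {linear P -> dsum R P}) (S : set P) :
  (forall x, lincomb id (s x) = x) ->
  (forall x y, S x -> submod_val (s x) y != 0 -> S y) ->
  projective (submod_type (lspan S)).
Proof.
move=> sK sS A B g f g_surj.
pose b := submod_of (lspan S).
(* Preimages are chosen for all of [P]; only those at points of [S] matter, and there [b] is the
   identity. *)
have /choice[a aP] : forall x, exists y, g y = f (b x).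
  move=> x; have : [set: B] (f (b x)) by [].
  by rewrite -g_surj => -[y _ <-]; exists y.
have supp y x : y \in lspan S -> submod_val (s y) x != 0 -> S x.
  move: y; apply: lspan_ind => [|c y z yS zS|y Sy]; last exact: sS.
  - by rewrite linear0 eqxx.
  - move=> sx; have [/zS//|/negPn/eqP sz0] := boolP (submod_val (s z) x != 0).
    apply: yS; apply: contraNN sx => /eqP sy0; rewrite linearP.
    rewrite -[eqbLHS]/(c *: submod_val (s y) x + submod_val (s z) x).
    by rewrite sy0 sz0 scaler0 addr0.
pose v : {linear submod_type (lspan S) -> P} := \val.
pose u : {linear dsum R P -> A} := lincomb a.
exists (u \o (s \o v)) => y.
have -> : f y = lincomb (f \o b) (s (v y)).
  rewrite -linear_lincomb; congr (f _); apply: submod_val_inj.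
  rewrite -[RHS]/(v (lincomb b (s (v y)))) linear_lincomb -[LHS]sK.
  apply: eq_lincomb => x /(supp _ _ (submod_valP y)) Sx.
  by rewrite /= /v /= submod_ofK //; exact: sub_lspan.
rewrite -[LHS]/(g (lincomb a (s (v y)))) linear_lincomb.
by apply: eq_lincomb => x _ /=; rewrite aP.
Qed.

(** * Countable closing-off *)

Section ClosedSubsets.
Variables (R : pzRingType).
Hypothesis hR :
  forall X : lmodType R, countably_generated X -> countably_presented X.
(** [B i] is the target of the differential leaving [P i]: later [M] for [i = 0] and the preceding
    term otherwise. [sigma x] will be the support of the section at [x]. *)
Variables (P B : nat -> lmodType R) (d : forall i, {linear P i.+1 -> P i}).
Variables (del : forall i, {linear P i -> B i}).
Hypothesis ex_d : forall i, exact_at (d i) (del i).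
Variable sigma : forall i, P i -> set (P i).
Hypothesis sigma_countable : forall i (x : P i), countable (sigma x).

(** A countable set of cycles spans all cycles of the span of [S]; by exactness each of them is a
    boundary, and [T] collects one preimage of each. *)
Lemma kernel_lift i (S : set (P i)) : countable S ->
  exists2 T : set (P i.+1), countable T &
    forall z, z \in lspan S -> del i z = 0 ->
      exists2 c, c \in lspan T & d i c = z.
Proof.
move=> /(kernel_countably_generated hR (del i))[K [cK K0] kerK].
have /choice[l lP] : forall z, exists c, K z -> d i c = z.
  move=> z; have [Kz|nKz] := pselect (K z); last by exists 0.
  have : [set b | del i b = 0] z by exact: K0.
  by rewrite -(ex_d i) => -[c _ <-]; exists c.
exists (l @` K); first exact: countable_image.
move=> z zS z0; apply: lspan_image; apply: lspan_mono (kerK z zS z0) => y Ky.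
by exists (l y); [exists y | exact: lP].
Qed.

Let family := {S : forall i, set (P i) | forall i, countable (S i)}.

Lemma closure_step (S : family) : exists S' : family,
  [/\ forall i, sval S i `<=` sval S' i,
      forall i x, sval S i x -> sigma x `<=` sval S' i,
      forall i x, sval S i.+1 x -> sval S' i (d i x)
    & forall i z, z \in lspan (sval S i) -> del i z = 0 ->
        exists2 c, c \in lspan (sval S' i.+1) & d i c = z].
Proof.
case: S => S cS /=.
pose T i : set (P i.+1) := sval (cid2 (kernel_lift (cS i))).
(* Preimages of cycles of degree [j] live in degree [j.+1], so degree 0 receives none. *)
pose T' i : set (P i) := if i is j.+1 then T j else set0.
pose S' i := S i `|` (\bigcup_(x in S i) sigma x `|` (d i @` S i.+1 `|` T' i)).
have cS' i : countable (S' i).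
  apply: countableU => //; apply: countableU.
    by apply: bigcup_countable.
  apply: countableU; first exact: countable_image.
  by case: i => [|i] //=; rewrite /T; case: cid2.
exists (exist _ S' cS'); split=> /=.
- by move=> i x; left.
- by move=> i x Sx y xy; right; left; exists x.
- by move=> i x Sx; right; right; left; exists x.
- move=> i z zS z0; have : exists2 c, c \in lspan (T i) & d i c = z.
    by rewrite /T; case: cid2 => /= ? _; exact.
  move=> [c cT <-]; exists c => //; apply: lspan_mono cT => y Ty.
  by right; right; right.
Qed.

(** The union of the iterates works: an element of [S i], or of its span, already appears at a
    finite stage, and the next stage meets its requirement. *)
Lemma countable_closure (C : forall i, set (P i)) :
  (forall i, countable (C i)) ->
  exists S : forall i, set (P i),
  [/\ forall i, countable (S i), forall i, C i `<=` S i,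
      forall i x, S i x -> sigma x `<=` S i,
      forall i x, S i.+1 x -> S i (d i x)
    & forall i z, z \in lspan (S i) -> del i z = 0 ->
        exists2 c, c \in lspan (S i.+1) & d i c = z].
Proof.
move=> cC; have /choice[next nextP] := closure_step.
pose S k := iter k next (exist _ C cC).
have Smono i : {homo (fun k => sval (S k) i) : m n / (m <= n)%N >-> m `<=` n}.
  apply: homo_leq => [A1|A1 A2 A3|k] //; first exact: subset_trans.
  by case: (nextP (S k)).
exists (fun i => \bigcup_k sval (S k) i); split.
- move=> i; apply: bigcup_countable => // k _; exact: (svalP (S k)).
- by move=> i x Cx; exists 0%N.
- move=> i x [k _ Skx] y xy; exists k.+1 => //.
  by case: (nextP (S k)) => _ H _ _; exact: (H i x).
- move=> i x [k _ Skx]; exists k.+1 => //.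
  by case: (nextP (S k)) => _ _ H _; exact: H.
- move=> i z /(lspan_bigcup (Smono i))[k zS] z0.
  case: (nextP (S k)) => _ _ _ /(_ i z zS z0)[c cS <-]; exists c => //.
  by apply: lspan_mono cS => x Sx; exists k.+1.
Qed.

End ClosedSubsets.

(** * Restricting the resolution to a submodule *)

Lemma exact_restrict (R : pzRingType) (A B C : lmodType R)
  (N1 : submodClosed A) (N2 : submodClosed B) (N3 : submodClosed C)
  (f : {linear A -> B}) (g : {linear B -> C})
  (f' : {linear submod_type N1 -> submod_type N2})
  (g' : {linear submod_type N2 -> submod_type N3}) :
  (forall x, submod_val (f' x) = f (submod_val x)) ->
  (forall x, submod_val (g' x) = g (submod_val x)) ->
  exact_at f g ->
  (forall z, z \in N2 -> g z = 0 -> exists2 c, c \in N1 & f c = z) ->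
  exact_at f' g'.
Proof.
move=> fE gE fg lift; apply/seteqP; split=> [_ [x _ <-]|z /= gz].
  have : range f (f (submod_val x)) by [].
  by rewrite fg => fx; apply: submod_val_inj; rewrite gE fE.
have [|c cN cz] := lift _ (submod_valP z); first by rewrite -gE gz.
by exists (SubmodType cN) => //; apply: submod_val_inj; rewrite fE.
Qed.

Lemma has_proj_resolution_submod (R : pzRingType)
  (hR : forall X : lmodType R, countably_generated X -> countably_presented X)
  (M : lmodType R) n (C : set M) : has_proj_resolution M n -> countable C ->
  exists N : submodClosed M, [/\ countably_generated (submod_type N),
    forall x, C x -> x \in N & has_proj_resolution (submod_type N) n].
Proof.
move=> [P [d [e [projP e_surj ex_e ex_d P0]]]] cC.
pose B i := if i is j.+1 then P j else M.
pose del i : {linear P i -> B i} :=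
  match i return {linear P i -> B i} with 0 => e | j.+1 => d j end.
have ex_del i : exact_at (d i) (del i) by case: i.
(* The type of the section depends on [i], so it is extracted degree by degree. *)
pose s i := sval (cid (projective_section (projP i))).
have sK i : forall x, lincomb id (s i x) = x.
  exact: svalP (cid (projective_section (projP i))).
pose sigma i x : set (P i) := [set y | submod_val (s i x) y != 0].
have csigma i x : countable (sigma i x).
  by apply: finite_set_countable; exact: finite_supp.
have /choice[l lP] : forall c, exists x, e x = c.
  move=> c; have : [set: M] c by [].
  by rewrite -e_surj => -[x _ <-]; exists x.
(* Only degree 0 is seeded, with preimages of [C] under the augmentation. *)
pose C' i : set (P i) :=
  match i return set (P i) with 0 => l @` C | _ => set0 end.
have cC' i : countable (C' i).
  by case: i => [|i]; [exact: countable_image | exact: countable0].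
have [S [cS CS sS dS kerS]] := countable_closure hR ex_del csigma cC'.
pose N0 : submodClosed M := lspan (e @` S 0%N).
have dN i x : x \in lspan (S i.+1) -> d i x \in lspan (S i).
  by apply: linear_lspan => y Sy; apply: sub_lspan; exact: dS.
have eN x : x \in lspan (S 0%N) -> e x \in N0.
  by apply: linear_lspan => y Sy; apply: sub_lspan; exists y.
pose dQ i := sval (cid (restrict_linear (@dN i))).
have dQE i x : submod_val (dQ i x) = d i (submod_val x).
  exact: svalP (cid (restrict_linear (@dN i))) x.
have [eQ eQE] := restrict_linear eN.
exists N0; split.
- by apply: countably_generated_lspan; exact: countable_image.
- move=> c Cc; apply: sub_lspan; exists (l c) => //.
  by apply: (CS 0%N); exists c.
- exists (fun i => submod_type (lspan (S i))), dQ, eQ; split.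
  + move=> i; apply: (@projective_lspan _ _ (s i)) => [|x y Sx].
      exact: sK.
    exact: sS.
  + apply/seteqP; split=> // y _.
    have [x xS xy] := lspan_image (submod_valP y).
    by exists (SubmodType xS) => //; apply: submod_val_inj; rewrite eQE.
  + exact: (exact_restrict (dQE 0%N) eQE ex_e (kerS 0%N)).
  + by move=> i; apply: (exact_restrict (dQE i.+1) (dQE i) (ex_d i) (kerS i.+1)).
  + by move=> i ni x; apply: submod_val_inj; exact: P0.
Qed.

(** * Projective dimension and the directed union *)

Lemma proj_dim_le (R : pzRingType) (M : lmodType R) n :
  has_proj_resolution M n -> (proj_dim M <= (Posz n)%:E)%E.
Proof.
move=> Mn; rewrite /proj_dim; case: pselect => [ex|]; last first.
  by case; exists n; exact/asboolP.
by case: ex_minnP => m _ /(_ n (asboolT Mn)); rewrite lee_fin lez_nat.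
Qed.

Lemma proj_dimP (R : pzRingType) (M : lmodType R) :
  (exists2 n, has_proj_resolution M n & proj_dim M = (Posz n)%:E) \/
  proj_dim M = +oo%E.
Proof.
rewrite /proj_dim; case: pselect => [ex|]; last by right.
by left; case: ex_minnP => n /asboolP Mn _; exists n.
Qed.

Lemma countable_sub_submod (R : pzRingType)
  (hR : forall X : lmodType R, countably_generated X -> countably_presented X)
  (M : lmodType R) (C : set M) : countable C ->
  exists N : submodClosed M, [/\ countably_generated (submod_type N),
    (proj_dim (submod_type N) <= proj_dim M)%E & forall x, C x -> x \in N].
Proof.
move=> cC; have [[n Mn ->]|->] := proj_dimP M.
  have [N [cN CN Nn]] := has_proj_resolution_submod hR Mn cC.
  by exists N; split=> //; exact: proj_dim_le.
(* For infinite projective dimension the bound is vacuous, so the span of [C] suffices. *)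
exists (lspan C : submodClosed M); split.
  exact: countably_generated_lspan.
  exact: leey.
by move=> x; exact: sub_lspan.
Qed.

Theorem proposition2p1 (R : pzRingType)
  (hR : forall X : lmodType R, countably_generated X -> countably_presented X)
  (M : lmodType R) :
  is_directed_union
    [set N : submodClosed M |
      countably_generated (submod_type N) /\
      (proj_dim (submod_type N) <= proj_dim M)%E].
Proof.
split.
- have [N [cN pN _]] := countable_sub_submod hR (countable0 M).
  by exists N.
- move=> N1 N2 [/countably_generated_submod[A1 cA1 N1A] _].
  move=> [/countably_generated_submod[A2 cA2 N2A] _].
  (* Closing off the union of two countable generating sets gives an upper bound of [N1] and
     [N2]. *)
  have [N [cN pN AN]] := countable_sub_submod hR (countableU cA1 cA2).
  exists N; split=> // x.
    by move=> /N1A; apply: lspan_sub => y Ay; apply: AN; left.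
  by move=> /N2A; apply: lspan_sub => y Ay; apply: AN; right.
- apply/seteqP; split=> // x _.
  have [N [cN pN xN]] := countable_sub_submod hR (countable1 x).
  by exists N => //=; exact: xN.
Qed.
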